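(* Let $f:[0,\infty)\to\mathbb{R}$ be the Fabius function. Let $n$ be a positive integer and let $a_1,a_3,a_5,\ldots$ be real numbers (possibly all but finitely many equal to zero) such that, for all $0\le x\le 1$, $$2^{2n^2}\left(f\left(\frac{1+x}{2^{2n}}\right)-f\left(\frac{1-x}{2^{2n}}\right)\right)=\sum_{k\ge 1}a_{2k-1}x^{2k-1}=a_1x+a_3x^3+a_5x^5+\cdots .$$ Then, for all $0\le x\le 1$, $$2^{2n^2+2n+1}\left(f\left(\frac{1+x}{2^{2n+1}}\right)+f\left(\frac{1-x}{2^{2n+1}}\right)\right)=\frac{1}{2^{2n}-1}\sum_{k\ge1}\frac{a_{2k-1}}{k(2k+1)}+\sum_{k\ge1}\frac{a_{2k-1}}{k}x^{2k}$$ $$=\frac{1}{2^{2n}-1}\left(\frac{a_1}{3}+\frac{a_3}{10}+\frac{a_5}{21}+\cdots\right)+a_1x^2+\frac{a_3}{2}x^4+\frac{a_5}{3}x^6+\cdots$$ and $$2^{2(n+1)^2}\left(f\left(\frac{1+x}{2^{2n+2}}\right)-f\left(\frac{1-x}{2^{2n+2}}\right)\right)=\frac{1}{2^{2n}-1}\left(\sum_{k\ge1}\frac{a_{2k-1}}{k(2k+1)}\right)x+\sum_{k\ge1}\frac{a_{2k-1}}{k(2k+1)}x^{2k+1}$$ $$=\frac{1}{2^{2n}-1}\left(\frac{a_1}{3}+\frac{a_3}{10}+\frac{a_5}{21}+\cdots\right)x+\frac{a_1}{3}x^3+\frac{a_3}{10}x^5+\frac{a_5}{21}x^7+\cdots 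.$$
   Context: The Fabius function is a continuous function $f:[0,\infty)\to\mathbb{R}$ satisfying $f(x)+f(1-x)=1$ for $0\le x\le 1$ and $f(x)=\int_0^{2x}f(t)\,dt$ for all $x\ge 0$. The sums are real series indexed by integers $k\ge1$; the hypothesis includes that the series $\sum_{k\ge1}a_{2k-1}x^{2k-1}$ converges for every $0\le x\le1$ (automatic if only finitely many $a_{2k-1}$ are nonzero), and the conclusion includes convergence of the series appearing in it. *)

(* Defs.v *)
From Stdlib Require Export Reals.
From Coquelicot Require Export Coquelicot.
Open Scope R_scope.

(* A function on [0, oo) is represented by a total [f : R -> R] whose values at
   negative arguments are left unconstrained and never used; in particular,
   continuity at 0 is one-sided. *)
Definition is_Fabius (f : R -> R) : Prop :=
  continuous_on (fun x => 0 <= x) f /\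
  (forall x, 0 <= x <= 1 -> f x + f (1 - x) = 1) /\
  (forall x, 0 <= x -> is_RInt f 0 (2 * x) (f x)).

(* Series over k >= 1: the value [u 0] is not used.  Convergence is that of the
   partial sums (not absolute), and [Sum1 u] is meaningful only together with
   [converges1 u]. *)
Definition converges1 (u : nat -> R) : Prop := ex_series (fun j => u (S j)).
Definition Sum1 (u : nat -> R) : R := Series (fun j => u (S j)).

(* Main.v *)
Require Import Defs.
From Stdlib Require Import Reals Lra Lia.
From Coquelicot Require Import Coquelicot.
Open Scope R_scope.

(** Substitution in [f(y) = int_0^(2y) f] shows that, up to powers of 2,
    [f((1+x)/2^(m+1)) + f((1-x)/2^(m+1))] and [f((1+x)/2^(m+1)) - f((1-x)/2^(m+1))]
    have as derivatives the corresponding difference and sum at level [m].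
    By Abel summation the given series converges uniformly on the closed interval
    from 0 to 1, so it may be integrated termwise twice.  The first integration leaves
    the value [P = 2^(2n^2+2n+2) f(1/2^(2n+1))] at [x = 0]; evaluating the second one
    at [x = 1], where [f(0) = 0], gives [2^(2n) P = P + sum_k a_(2k-1)/(k(2k+1))]. *)

(** The bound is non-strict so that it survives both integration and the passage to the limit along
    a tail. *)
Definition unif_series (u : nat -> R -> R) (g : R -> R) : Prop :=
  forall eps, 0 < eps -> exists N, forall n, (N <= n)%nat ->
    forall x, 0 <= x <= 1 -> Rabs (sum_n (fun j => u j x) n - g x) <= eps.

Lemma unif_series_is_series (u : nat -> R -> R) (g : R -> R) (x : R) :
  unif_series u g -> 0 <= x <= 1 -> is_series (fun j => u j x) (g x).
Proof.
intros Hu Hx.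
change (is_lim_seq (sum_n (fun j => u j x)) (g x)).
apply is_lim_seq_spec; intros eps.
assert (He : 0 < eps / 2) by (destruct eps; simpl; lra).
destruct (Hu _ He) as [N HN].
exists N; intros n Hn.
apply Rle_lt_trans with (1 := HN n Hn x Hx).
destruct eps; simpl in *; lra.
Qed.

Lemma is_RInt_sum_n (u : nat -> R -> R) (a b : R) (l : nat -> R) (n : nat) :
  (forall j, is_RInt (u j) a b (l j)) ->
  is_RInt (fun t => sum_n (fun j => u j t) n) a b (sum_n l n).
Proof.
intros H; induction n as [|n IH].
- rewrite sum_O.
  apply is_RInt_ext with (2 := H 0%nat).
  intros t _; now rewrite sum_O.
- rewrite sum_Sn.
  eapply is_RInt_ext; [|exact (is_RInt_plus _ _ _ _ _ _ IH (H (S n)))].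
  intros t _; now rewrite sum_Sn.
Qed.

(** Integrating the error from 0 to [x] multiplies its bound by [x <= 1], so the same [N] serves for
    the integrated series. *)
Lemma unif_series_RInt (u U : nat -> R -> R) (g h : R -> R) :
  unif_series u g ->
  (forall j x, 0 <= x <= 1 -> is_RInt (u j) 0 x (U j x)) ->
  (forall x, 0 <= x <= 1 -> is_RInt g 0 x (h x)) ->
  unif_series U h.
Proof.
intros Hu HU Hh eps Heps.
destruct (Hu eps Heps) as [N HN].
exists N; intros n Hn x Hx.
assert (HI : is_RInt (fun t => minus (sum_n (fun j => u j t) n) (g t)) 0 x
               (minus (sum_n (fun j => U j x) n) (h x))).
{ refine (is_RInt_minus _ _ _ _ _ _ _ (Hh x Hx)).
  apply is_RInt_sum_n; intros j; now apply HU. }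
apply Rle_trans with ((x - 0) * eps).
- refine (norm_RInt_le_const _ 0 x _ eps (proj1 Hx) _ HI).
  intros t Ht; apply (HN n Hn); lra.
- nra.
Qed.

(** Summation by parts: with [s_j] the partial sums of [d], the weighted sum is [s_M u_M] plus the
    sum over [j < M] of [s_j (u_j - u_(j+1))]. The factors [u_M] and [u_j - u_(j+1)] are nonnegative
    and telescope to [u_0]. *)
Lemma abel_bound (d u : nat -> R) (eps : R) :
  (forall j, 0 <= u (S j) <= u j) ->
  (forall M, Rabs (sum_n d M) <= eps) ->
  forall M, Rabs (sum_n (fun j => d j * u j) M) <= eps * u 0%nat.
Proof.
intros Hu Hd M.
assert (Hparts : Rabs (sum_n (fun j => d j * u j) M - sum_n d M * u M)
                 <= eps * (u 0%nat - u M)).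
{ induction M as [|M IH].
  - rewrite !sum_O, Rminus_diag, Rabs_R0; lra.
  - rewrite !sum_Sn; unfold plus; simpl.
    replace (_ - _) with
      ((sum_n (fun j => d j * u j) M - sum_n d M * u M)
       + sum_n d M * (u M - u (S M))) by ring.
    apply Rle_trans with (1 := Rabs_triang _ _).
    rewrite Rabs_mult, (Rabs_pos_eq (u M - u (S M))) by (specialize (Hu M); lra).
    assert (Rabs (sum_n d M) * (u M - u (S M)) <= eps * (u M - u (S M))).
    { apply Rmult_le_compat_r; [specialize (Hu M); lra | apply Hd]. }
    lra. }
assert (HuM : 0 <= u M) by (destruct M; [specialize (Hu 0%nat) | specialize (Hu M)]; lra).
assert (Rabs (sum_n d M * u M) <= eps * u M).
{ rewrite Rabs_mult, (Rabs_pos_eq (u M)) by assumption.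
  apply Rmult_le_compat_r; [assumption | apply Hd]. }
replace (sum_n (fun j => d j * u j) M) with
  ((sum_n (fun j => d j * u j) M - sum_n d M * u M) + sum_n d M * u M) by ring.
apply Rle_trans with (1 := Rabs_triang _ _); lra.
Qed.

Lemma sum_n_shift (c : nat -> R) (n M : nat) :
  sum_n (fun k => c (n + k)%nat) M = sum_n_m c n (n + M).
Proof.
induction M as [|M IH].
- now rewrite sum_O, Nat.add_0_r, sum_n_n.
- rewrite sum_Sn, IH, Nat.add_succ_r, sum_n_Sm by lia; reflexivity.
Qed.

(** Abel's test: the Cauchy bound on blocks of [c] does not involve [x], and decreasing weights
    between 0 and 1 preserve it. *)
Lemma unif_series_abel (c : nat -> R) (v : nat -> R -> R) :
  ex_series c ->
  (forall j x, 0 <= x <= 1 -> 0 <= v (S j) x <= v j x) ->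
  (forall x, 0 <= x <= 1 -> v 0%nat x <= 1) ->
  (forall x, 0 <= x <= 1 -> ex_series (fun j => c j * v j x)) ->
  unif_series (fun j x => c j * v j x) (fun x => Series (fun j => c j * v j x)).
Proof.
intros Hc Hv Hv0 Hex eps Heps.
destruct (Cauchy_ex_series c Hc (mkposreal _ Heps)) as [N HN].
exists N; intros n Hn x Hx.
set (w := fun j => c j * v j x); set (s := Series w).
assert (Hv1 : forall j, v j x <= 1).
{ induction j as [|j IH]; [now apply Hv0|].
  specialize (Hv j x Hx); lra. }
assert (Hpart : forall M, Rabs (sum_n (fun k => w (S n + k)%nat) M) <= eps).
{ intros M.
  apply Rle_trans with (eps * v (S n + 0)%nat x).
  - apply (abel_bound (fun k => c (S n + k)%nat) (fun k => v (S n + k)%nat x)).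
    + intros j; rewrite Nat.add_succ_r; now apply Hv.
    + intros K; rewrite sum_n_shift.
      apply Rlt_le, (HN (S n) (S n + K)%nat); lia.
  - specialize (Hv1 (S n + 0)%nat); nra. }
(* [sum_n w n] includes the index [n], so the remainder starts at [S n]. *)
assert (Htail : is_series (fun k => w (S n + k)%nat) (s - sum_n w n)).
{ apply is_series_incr_n; [lia|].
  replace (plus _ _) with s
    by (change (s = s - sum_n w n + sum_n w n); ring).
  apply Series_correct; now apply Hex. }
rewrite Rabs_minus_sym.
apply (is_lim_seq_abs _ (Finite (s - sum_n w n))) in Htail.
exact (is_lim_seq_le _ _ _ (Finite eps) Hpart Htail (is_lim_seq_const eps)).
Qed.

Lemma is_RInt_pow (p : nat) (x : R) :
  is_RInt (fun t => t ^ p) 0 x (x ^ S p / INR (S p)).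
Proof.
assert (Hp : INR (S p) <> 0) by (apply not_0_INR; lia).
replace (x ^ S p / INR (S p)) with (minus (x ^ S p / INR (S p)) (0 ^ S p / INR (S p))).
2: { unfold minus, plus, opp; simpl pow; simpl plus; unfold Rdiv; simpl; ring. }
apply (is_RInt_derive (fun t => t ^ S p / INR (S p)) (fun t => t ^ p)).
- intros t _.
  auto_derive; [easy|].
  change (match p with O => 1 | S _ => INR p + 1 end) with (INR (S p)).
  field; exact Hp.
- intros t _; apply (ex_derive_continuous (fun t => t ^ p)); auto_derive; easy.
Qed.

Lemma Fabius_0 (f : R -> R) : is_Fabius f -> f 0 = 0.
Proof.
intros (_ & _ & H).
specialize (H 0 (Rle_refl 0)); rewrite Rmult_0_r in H.
rewrite <- (is_RInt_unique _ _ _ _ H); exact (RInt_point 0 f).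
Qed.

(** The integral is split at 0. No order between [u] and [v] is imposed, because the substitution
    [1 - t] below runs the interval backwards. *)
Lemma Fabius_RInt (f : R -> R) (u v : R) :
  is_Fabius f -> 0 <= u -> 0 <= v -> is_RInt f u v (f (v / 2) - f (u / 2)).
Proof.
intros (_ & _ & H) Hu Hv.
assert (Hu2 := H (u / 2) ltac:(lra)); assert (Hv2 := H (v / 2) ltac:(lra)).
replace (2 * (u / 2)) with u in Hu2 by field.
replace (2 * (v / 2)) with v in Hv2 by field.
replace (f (v / 2) - f (u / 2)) with (plus (opp (f (u / 2))) (f (v / 2)))
  by (unfold plus, opp; simpl; ring).
exact (is_RInt_Chasles _ _ _ _ _ _ (is_RInt_swap _ _ _ _ Hu2) Hv2).
Qed.

(** The values [s = 1] and [s = -1] treat both arguments [1 + t] and [1 - t] at once; [2 ^ m / s] is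
    the inverse of the slope of the substitution. *)
Lemma Fabius_RInt_lin (f : R -> R) (s : R) (m : nat) (x : R) :
  is_Fabius f -> s <> 0 -> 0 <= 1 + s * x ->
  is_RInt (fun t => f ((1 + s * t) / 2 ^ m)) 0 x
    (2 ^ m / s * (f ((1 + s * x) / 2 ^ S m) - f (1 / 2 ^ S m))).
Proof.
intros Hf Hs Hx.
assert (H2 : 0 < 2 ^ m) by (apply pow_lt; lra).
(* The endpoints are written as images of 0 and [x] under an affine map, the shape that
   [is_RInt_comp_lin] matches. *)
assert (HI := Fabius_RInt f (s / 2 ^ m * 0 + 1 / 2 ^ m) (s / 2 ^ m * x + 1 / 2 ^ m) Hf).
assert (H1 : 0 < 1 / 2 ^ m) by (apply Rdiv_lt_0_compat; lra).
assert (H3 : 0 <= s / 2 ^ m * x + 1 / 2 ^ m).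
{ replace (_ + _) with ((1 + s * x) / 2 ^ m) by (field; lra).
  apply Rdiv_le_0_compat; lra. }
specialize (HI ltac:(lra) H3).
apply is_RInt_comp_lin in HI.
apply (is_RInt_scal _ _ _ (2 ^ m / s)) in HI.
replace (f ((1 + s * x) / 2 ^ S m)) with (f ((s / 2 ^ m * x + 1 / 2 ^ m) / 2))
  by (f_equal; simpl; field; lra).
replace (f (1 / 2 ^ S m)) with (f ((s / 2 ^ m * 0 + 1 / 2 ^ m) / 2))
  by (f_equal; simpl; field; lra).
eapply is_RInt_ext; [|exact HI].
intros t _; unfold scal; simpl; unfold mult; simpl.
replace (s / 2 ^ m * t + 1 / 2 ^ m) with ((1 + s * t) / 2 ^ m) by (field; lra).
field; split; lra.
Qed.

(** For [s = -1] the factor [2 ^ m / s] is negative, so the difference of integrands yields a sum of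
    values, and the two constants at [1 / 2 ^ S m] add up. *)
Lemma Fabius_RInt_diff (f : R -> R) (m : nat) (x : R) :
  is_Fabius f -> 0 <= x <= 1 ->
  is_RInt (fun t => f ((1 + t) / 2 ^ m) - f ((1 - t) / 2 ^ m)) 0 x
    (2 ^ m * (f ((1 + x) / 2 ^ S m) + f ((1 - x) / 2 ^ S m) - 2 * f (1 / 2 ^ S m))).
Proof.
intros Hf Hx.
assert (Hp := Fabius_RInt_lin f 1 m x Hf ltac:(lra) ltac:(lra)).
assert (Hq := Fabius_RInt_lin f (-1) m x Hf ltac:(lra) ltac:(lra)).
assert (HI := is_RInt_minus _ _ _ _ _ _ Hp Hq).
replace (1 + 1 * x) with (1 + x) in HI by ring.
replace (1 + -1 * x) with (1 - x) in HI by ring.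
replace (2 ^ m * _) with
  (minus (2 ^ m / 1 * (f ((1 + x) / 2 ^ S m) - f (1 / 2 ^ S m)))
     (2 ^ m / -1 * (f ((1 - x) / 2 ^ S m) - f (1 / 2 ^ S m))))
  by (unfold minus, plus, opp; simpl; field).
eapply is_RInt_ext; [|exact HI].
intros t _; unfold minus, plus, opp; simpl.
now replace (1 + 1 * t) with (1 + t) by ring; replace (1 + -1 * t) with (1 - t) by ring.
Qed.

(** Here the opposite signs of [2 ^ m / s] make the constants at [1 / 2 ^ S m] cancel. *)
Lemma Fabius_RInt_sum (f : R -> R) (m : nat) (x : R) :
  is_Fabius f -> 0 <= x <= 1 ->
  is_RInt (fun t => f ((1 + t) / 2 ^ m) + f ((1 - t) / 2 ^ m)) 0 x
    (2 ^ m * (f ((1 + x) / 2 ^ S m) - f ((1 - x) / 2 ^ S m))).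
Proof.
intros Hf Hx.
assert (Hp := Fabius_RInt_lin f 1 m x Hf ltac:(lra) ltac:(lra)).
assert (Hq := Fabius_RInt_lin f (-1) m x Hf ltac:(lra) ltac:(lra)).
assert (HI := is_RInt_plus _ _ _ _ _ _ Hp Hq).
replace (1 + 1 * x) with (1 + x) in HI by ring.
replace (1 + -1 * x) with (1 - x) in HI by ring.
replace (2 ^ m * _) with
  (plus (2 ^ m / 1 * (f ((1 + x) / 2 ^ S m) - f (1 / 2 ^ S m)))
     (2 ^ m / -1 * (f ((1 - x) / 2 ^ S m) - f (1 / 2 ^ S m))))
  by (unfold plus; simpl; field).
eapply is_RInt_ext; [|exact HI].
intros t _; unfold plus; simpl.
now replace (1 + 1 * t) with (1 + t) by ring; replace (1 + -1 * t) with (1 - t) by ring.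
Qed.

Theorem theorem1 (f : R -> R) (Hf : is_Fabius f) (n : nat) (Hn : (1 <= n)%nat)
  (a : nat -> R)
  (Ha : forall x : R, 0 <= x <= 1 ->
     converges1 (fun k => a (2 * k - 1)%nat * x ^ (2 * k - 1)) /\
     2 ^ (2 * n ^ 2) * (f ((1 + x) / 2 ^ (2 * n)) - f ((1 - x) / 2 ^ (2 * n)))
     = Sum1 (fun k => a (2 * k - 1)%nat * x ^ (2 * k - 1))) :
  converges1 (fun k => a (2 * k - 1)%nat / (INR k * INR (2 * k + 1))) /\
  (forall x : R, 0 <= x <= 1 ->
     converges1 (fun k => a (2 * k - 1)%nat / INR k * x ^ (2 * k)) /\
     2 ^ (2 * n ^ 2 + 2 * n + 1) *
       (f ((1 + x) / 2 ^ (2 * n + 1)) + f ((1 - x) / 2 ^ (2 * n + 1)))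
     = 1 / (2 ^ (2 * n) - 1) *
         Sum1 (fun k => a (2 * k - 1)%nat / (INR k * INR (2 * k + 1)))
       + Sum1 (fun k => a (2 * k - 1)%nat / INR k * x ^ (2 * k))) /\
  (forall x : R, 0 <= x <= 1 ->
     converges1 (fun k => a (2 * k - 1)%nat / (INR k * INR (2 * k + 1)) * x ^ (2 * k + 1)) /\
     2 ^ (2 * (n + 1) ^ 2) *
       (f ((1 + x) / 2 ^ (2 * n + 2)) - f ((1 - x) / 2 ^ (2 * n + 2)))
     = 1 / (2 ^ (2 * n) - 1) *
         Sum1 (fun k => a (2 * k - 1)%nat / (INR k * INR (2 * k + 1))) * x
       + Sum1 (fun k => a (2 * k - 1)%nat / (INR k * INR (2 * k + 1)) * x ^ (2 * k + 1))).
Proof.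
(* Reindexing by [k = S j] turns sums over [k >= 1] into series from 0. *)
set (c := fun j => a (2 * S j - 1)%nat).
set (F := fun x => f ((1 + x) / 2 ^ (2 * n + 1)) + f ((1 - x) / 2 ^ (2 * n + 1))).
set (D := fun x => f ((1 + x) / 2 ^ (2 * n + 2)) - f ((1 - x) / 2 ^ (2 * n + 2))).
(* The constant of integration: [4 * (E * q * K)] is the [P] of the overview. *)
set (K := f (1 / 2 ^ (2 * n + 1))).
set (E := 2 ^ (2 * n ^ 2)); set (q := 2 ^ (2 * n)).
(* [n >= 1] enters here and makes [q - 1] invertible. *)
assert (Hq : 1 < q) by (apply Rlt_pow_R1; [lra | lia]).
assert (Hpow1 : 2 ^ (2 * n ^ 2 + 2 * n + 1) = 2 * (E * q)).
{ unfold E, q; rewrite !pow_add; ring. }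
assert (Hpow2 : 2 ^ (2 * (n + 1) ^ 2) = 4 * (E * (q * q))).
{ replace (2 * (n + 1) ^ 2)%nat with (2 * n ^ 2 + 2 * n + 2 * n + 2)%nat
    by (simpl; ring).
  unfold E, q; rewrite !pow_add; ring. }
assert (Hpow3 : 2 ^ (2 * n + 1) = 2 * q) by (unfold q; rewrite pow_add; ring).
set (v := fun j (x : R) => x ^ (2 * S j - 1)).
assert (H0 : unif_series (fun j x => c j * v j x) (fun x => Series (fun j => c j * v j x))).
{ apply unif_series_abel.
  (* The hypothesis at [x = 1] is the convergence of the coefficients themselves. *)
  - apply ex_series_ext with (2 := proj1 (Ha 1 ltac:(lra))).
    intros j; simpl; now rewrite pow1, Rmult_1_r.
  - intros j x Hx; unfold v.
    (* Consecutive weights differ by the factor [x ^ 2], which lies between 0 and 1. *)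
    replace (2 * S (S j) - 1)%nat with (2 + (2 * S j - 1))%nat by lia.
    assert (H := pow_le x (2 * S j - 1) (proj1 Hx)).
    assert (Hx2 : 0 <= x ^ 2 <= 1) by (simpl; nra).
    rewrite pow_add; split; nra.
  - intros x Hx; unfold v; simpl; lra.
  - intros x Hx; exact (proj1 (Ha x Hx)). }
assert (H1 : unif_series (fun j x => c j * (x ^ (2 * S j) / INR (2 * S j)))
               (fun x => E * (q * (F x - 2 * K)))).
{ apply unif_series_RInt with (1 := H0).
  - intros j x Hx; assert (HI := is_RInt_pow (2 * S j - 1) x).
    replace (S (2 * S j - 1)) with (2 * S j)%nat in HI by lia.
    exact (is_RInt_scal _ _ _ (c j) _ HI).
  - intros x Hx.
    assert (HI := is_RInt_scal _ _ _ E _ (Fabius_RInt_diff f (2 * n) x Hf Hx)).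
    replace (S (2 * n)) with (2 * n + 1)%nat in HI by lia.
    eapply is_RInt_ext; [|exact HI].
    (* The given expansion holds on [[0, 1]] only, so the bounds on [t] are kept. *)
    intros t; rewrite Rmin_left, Rmax_right by lra; intros Ht.
    exact (proj2 (Ha t ltac:(lra))). }
assert (H2 : unif_series
               (fun j x => c j / INR (2 * S j) * (x ^ (2 * S j + 1) / INR (2 * S j + 1)))
               (fun x => E * q * (2 * q * D x - 2 * K * x))).
{ apply unif_series_RInt with (1 := H1).
  - intros j x Hx.
    replace (2 * S j + 1)%nat with (S (2 * S j)) by lia.
    assert (HI := is_RInt_scal _ _ _ (c j / INR (2 * S j)) _ (is_RInt_pow (2 * S j) x)).
    eapply is_RInt_ext; [|exact HI].
    intros t _; unfold scal; simpl; unfold mult, Rdiv; simpl; ring.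
  - intros x Hx.
    assert (HI := Fabius_RInt_sum f (2 * n + 1) x Hf Hx).
    replace (S (2 * n + 1)) with (2 * n + 2)%nat in HI by lia.
    assert (HC := is_RInt_const 0 x (2 * K)).
    assert (HS := is_RInt_scal _ _ _ (E * q) _ (is_RInt_minus _ _ _ _ _ _ HI HC)).
    replace (E * q * _) with
      (scal (E * q) (minus (2 ^ (2 * n + 1) * D x) (scal (x - 0) (2 * K))))
      by (rewrite Hpow3; unfold scal, minus, plus, opp; simpl; unfold mult; simpl; ring).
    eapply is_RInt_ext; [|exact HS].
    intros t _; unfold scal, minus, plus, opp, F; simpl; unfold mult; simpl; ring. }
(* Doubling turns the denominators [2k] left by the first integration into [k]. *)
assert (S1 : forall x, 0 <= x <= 1 ->
  is_series (fun j => a (2 * S j - 1)%nat / INR (S j) * x ^ (2 * S j))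
    (2 * (E * (q * (F x - 2 * K))))).
{ intros x Hx.
  eapply is_series_ext;
    [|exact (is_series_scal 2 _ _ (unif_series_is_series _ _ x H1 Hx))].
  intros j; unfold scal; cbn -[INR Nat.mul pow]; unfold mult; cbn -[INR Nat.mul pow].
  rewrite (mult_INR 2 (S j)); change (INR 2) with 2; unfold c.
  field; apply not_0_INR; lia. }
assert (S2 : forall x, 0 <= x <= 1 ->
  is_series (fun j => a (2 * S j - 1)%nat / (INR (S j) * INR (2 * S j + 1))
                      * x ^ (2 * S j + 1))
    (2 * (E * q * (2 * q * D x - 2 * K * x)))).
{ intros x Hx.
  eapply is_series_ext;
    [|exact (is_series_scal 2 _ _ (unif_series_is_series _ _ x H2 Hx))].
  intros j; unfold scal; cbn -[INR Nat.mul Nat.add pow]; unfold mult;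
    cbn -[INR Nat.mul Nat.add pow].
  rewrite (mult_INR 2 (S j)); change (INR 2) with 2; unfold c.
  field; split; apply not_0_INR; lia. }
(* At [x = 1] the second term is [f 0 = 0], and the first has argument [2 / 2 ^ (2 * n + 2)]. *)
assert (HD1 : D 1 = K).
{ unfold D, K; rewrite Rminus_diag; unfold Rdiv at 2; rewrite Rmult_0_l, (Fabius_0 f Hf).
  rewrite Rminus_0_r; f_equal.
  replace (2 * n + 2)%nat with (2 * n + 1 + 1)%nat by lia.
  rewrite (pow_add 2 (2 * n + 1)), Hpow3; field; lra. }
(* Evaluating the second integrated series at [x = 1] gives an equation for [K]: the sum is
   [(q - 1) P]. *)
assert (S3 : is_series (fun j => a (2 * S j - 1)%nat / (INR (S j) * INR (2 * S j + 1)))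
               (4 * (E * q * K) * (q - 1))).
{ replace (_ * _) with (2 * (E * q * (2 * q * D 1 - 2 * K * 1))) by (rewrite HD1; ring).
  eapply is_series_ext; [|exact (S2 1 ltac:(lra))].
  intros j; cbv beta; now rewrite pow1, Rmult_1_r. }
unfold converges1, Sum1.
(* With this sum known, [1 / (q - 1)] times it is [4 * (E * q * K)], which cancels the [K] terms of
   [S1] and [S2]. *)
rewrite (is_series_unique _ _ S3), Hpow1, Hpow2.
split; [now exists (4 * (E * q * K) * (q - 1))|].
split; intros x Hx; split.
- eexists; exact (S1 x Hx).
- rewrite (is_series_unique _ _ (S1 x Hx)).
  fold (F x); field; lra.
- eexists; exact (S2 x Hx).
- rewrite (is_series_unique _ _ (S2 x Hx)).
  fold (D x); field; lra.
Qed.
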